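(* Let $\mathfrak{U}$ be a Banach algebra. (i) If $\phi\in\Delta(\mathfrak{U})$ and $\mathfrak{U}$ is $\phi$-Johnson amenable, then every continuous point Jordan derivation at $\phi$ on $\mathfrak{U}$ is equal to zero. (ii) If $\mathfrak{U}$ is character amenable, then for each $\phi\in\Delta(\mathfrak{U})$ every continuous point Jordan derivation at $\phi$ on $\mathfrak{U}$ is equal to zero. (iii) If $\mathfrak{U}$ is amenable, then for each $\phi\in\Delta(\mathfrak{U})$ every continuous point Jordan derivation at $\phi$ on $\mathfrak{U}$ is equal to zero.
   Context: Banach algebras are complex. $\Delta(\mathfrak{U})$ is the set of all non-zero multiplicative linear functionals on $\mathfrak{U}$. For a Banach $\mathfrak{U}$-bimodule $X$, the dual $X^*$ is a Banach $\mathfrak{U}$-bimodule via $\langle a\cdot f,x\rangle=\langle f,x\cdot a\rangle$ and $\langle f\cdot a,x\rangle=\langle f,a\cdot x\rangle$. For $\phi\in\Delta(\mathfrak{U})$, a point Jordan derivation at $\phi$ on $\mathfrak{U}$ is a Jordan derivation $\delta:\mathfrak{U}\to\mathbb{C}$, where $\mathbb{C}$ is the $\mathfrak{U}$-bimodule with $a\cdot z=z\cdot a=\phi(a)z$; that is, a linear map $\delta:\mathfrak{U}\to\mathbb{C}$ with $\delta(a^2)=2\phi(a)\delta(a)$ for all $a\in\mathfrak{U}$. The projective tensor product $\mathfrak{U}\widehat{\otimes}\mathfrak{U}$ is a Banach $\mathfrak{U}$-bimodule via $a\cdot(b\otimes c)=ab\otimes c$ and $(b\otimes c)\cdot a=b\otimes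 ca$; $\pi:\mathfrak{U}\widehat{\otimes}\mathfrak{U}\to\mathfrak{U}$ is the continuous linear map with $\pi(b\otimes c)=bc$. $\mathfrak{U}$ is $\phi$-Johnson amenable if there exists $m\in(\mathfrak{U}\widehat{\otimes}\mathfrak{U})^{**}$ such that $a\cdot m=m\cdot a$ for every $a\in\mathfrak{U}$ and $\tilde\phi\circ\pi^{**}(m)=1$, where $\tilde\phi(F)=F(\phi)$ for $F\in\mathfrak{U}^{**}$. A linear map $\delta:\mathfrak{U}\to X$ is a derivation if $\delta(ab)=\delta(a)\cdot b+a\cdot\delta(b)$ for all $a,b\in\mathfrak{U}$; it is inner if for some $x\in X$, $\delta(a)=a\cdot x-x\cdot a$ for all $a$. $\mathfrak{U}$ is amenable if for every Banach $\mathfrak{U}$-bimodule $X$, every continuous derivation $\mathfrak{U}\to X^*$ is inner. $\mathfrak{U}$ is character amenable if, for all $\phi\in\Delta(\mathfrak{U})\cup\{0\}$ and all Banach $\mathfrak{U}$-bimodules $X$ such that either $x\cdot a=\phi(a)x$ for all $a\in\mathfrak{U},x\in X$, or $a\cdot x=\phi(a)x$ for all $a\in\mathfrak{U},x\in X$, every continuous derivation $\mathfrak{U}\to X^*$ is inner. *)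

(* Defs.v *)
From HB Require Import structures.
From mathcomp Require Import all_boot all_order all_algebra.
From mathcomp Require Import complex.
From mathcomp Require Import boolp classical_sets functions reals topology normedtype sequences.
Set Implicit Arguments.
Unset Strict Implicit.
Unset Printing Implicit Defensive.
Import Order.TTheory GRing.Theory Num.Theory.
Import numFieldNormedType.Exports.
Local Open Scope classical_set_scope.
Local Open Scope ring_scope.
Local Open Scope complex_scope.

Local Notation Re := complex.Re.
Local Notation Im := complex.Im.
(* The norm of an [R[i]]-module takes its values in the nonnegative reals of
   [R[i]], ordered by [x <= y] iff [y - x] is a nonnegative real. *)
HB.instance Definition _ (R : realType) := NormedModule.copy R[i] R[i]^o.

Section ComplexNumbers.
Variable R : realType.
Implicit Types z : R[i].

Lemma normc_Re z : (Re `|z|)%:C = `|z|.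
Proof. by rewrite RRe_real ?normr_real. Qed.

Lemma normc_i : `|'i%C| = 1 :> R[i].
Proof. by rewrite normc_def /= expr0n expr1n add0r sqrtr1. Qed.

Lemma normc_ge_Im z : `|Im z|%:C <= `|z|.
Proof.
have := normc_ge_Re (- 'i%C * z).
have -> : Re (- 'i%C * z) = Im z.
  by case: z => a b /=; rewrite oppr0 mul0r mulN1r opprK add0r.
by rewrite normrM normrN normc_i mul1r.
Qed.

Lemma normc_le_ReIm z : `|z| <= `|Re z|%:C + `|Im z|%:C.
Proof.
rewrite {1}(complexE z) (le_trans (ler_normD _ _))// normrM normc_i mul1r.
by rewrite !normc_def /= !expr0n /= !addr0 !sqrtr_sqr.
Qed.

Lemma complex_complete (F : set_system R[i]) :
  ProperFilter F -> cauchy F -> cvg F.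
Proof.
move=> FF /cauchy_ballP Fc.
have proj_cvg (p : R[i] -> R) : (forall z, `|p z|%:C <= `|z|) ->
    {morph p : x y / x - y} -> cvg (p @ F).
  move=> p_le pB; apply: R_complete; apply/cauchy_ballP => e e0.
  rewrite near_map2.
  have e0' : 0 < e%:C by rewrite ltcR.
  apply: filterS (Fc _ e0') => -[x y] /=.
  rewrite -!ball_normE /= -pB => xye.
  by rewrite -ltcR (le_lt_trans (p_le _)).
have /cvg_ex[/= a Fa] := proj_cvg _ (@normc_ge_Re R) (raddfB _).
have /cvg_ex[/= b Fb] := proj_cvg _ normc_ge_Im (raddfB _).
apply/cvg_ex; exists (a +i* b); apply/cvgrPdist_le => e e0.
have eE : e = (Re e)%:C by rewrite RRe_real ?gtr0_real.
have e20 : 0 < Re e / 2 by rewrite divr_gt0// -ltcR -eE.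
move/cvgrPdist_le : Fa => /(_ _ e20) Fa.
move/cvgrPdist_le : Fb => /(_ _ e20) Fb.
apply: filterS2 Fa Fb => z az bz.
apply: le_trans (normc_le_ReIm _) _.
rewrite eE (splitr (Re e)) -rmorphD lecR.
by case: z az bz => u v /= az bz; rewrite lerD.
Qed.

HB.instance Definition _ := Uniform_isComplete.Build R[i] complex_complete.

End ComplexNumbers.

Section ContinuousLinearMaps.
Variables (R : realType) (X Y : normedModType R[i]).

Definition contlin_pred : {pred X -> Y} :=
  [pred f | `[< linear f /\ continuous f >]].

Record contlin : Type := ContLin {
  contlin_fun :> X -> Y;
  contlin_subproof : contlin_fun \in contlin_pred }.
Implicit Types f g : contlin.

HB.instance Definition _ := [isSub for contlin_fun].
HB.instance Definition _ := gen_eqMixin contlin.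
HB.instance Definition _ := gen_choiceMixin contlin.

Lemma contlin_linear (f : contlin) : linear f.
Proof. by have /asboolP[] := contlin_subproof f. Qed.

Lemma contlin_continuous (f : contlin) : continuous f.
Proof. by have /asboolP[] := contlin_subproof f. Qed.

HB.instance Definition _ (f : contlin) :=
  GRing.isLinear.Build R[i] X Y *:%R f (contlin_linear f).

Definition mk_contlin (f : X -> Y) (lf : linear f) (cf : continuous f) :
  contlin := ContLin (asboolT (conj lf cf)).

Lemma contlinP (f g : contlin) : f =1 g -> f = g.
Proof. by move=> fg; apply/val_inj/funext. Qed.

Lemma contlin_submod_closed : submod_closed contlin_pred.
Proof.
split; first by apply/asboolP; split; [move=> k x y /=; rewrite scaler0 addr0|exact: cst_continuous].
move=> k f g /asboolP[lf cf] /asboolP[lg cg]; apply/asboolP; split.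
  move=> l x y; rewrite -[LHS]/(k *: f (l *: x + y) + g (l *: x + y)).
  rewrite lf lg scalerDr !scalerA (mulrC k l) addrACA -scalerA -scalerDr.
  by [].
move=> x; apply: cvgD; [apply: cvgZr; exact: cf|exact: cg].
Qed.

HB.instance Definition _ := GRing.isSubmodClosed.Build R[i] (X -> Y)
  contlin_pred contlin_submod_closed.
HB.instance Definition _ := [SubChoice_isSubLmodule of contlin by <:].

Lemma contlin_addE (f g : contlin) x : (f + g) x = f x + g x.
Proof. by []. Qed.

Lemma contlin_scaleE k (f : contlin) x : (k *: f) x = k *: f x.
Proof. by []. Qed.

Lemma linear_continuous_bound (f : {linear X -> Y}) (M : R) :
  (forall x, `|f x| <= M%:C * `|x|) -> continuous f.
Proof.
move=> fM; apply/linear_bounded_continuous/linear_boundedP.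
exists `|M|%:C; split; first by apply/complex_realP; exists `|M|.
move=> r Mr x; apply: le_trans (fM x) _; apply: ler_wpM2r => //.
by apply: le_trans (ltW Mr); rewrite lecR ler_norm.
Qed.

Lemma contlin_bounded (f : contlin) :
  exists2 M : R, 0 <= M & forall x, `|f x| <= M%:C * `|x|.
Proof.
have /linear_bounded_continuous/linear_boundedP := @contlin_continuous f.
move=> [M [Mr fM]].
have M1 : M < (Re M + 1)%:C by rewrite -{1}(RRe_real Mr) ltcR ltrDl.
exists `|Re M + 1| => // x.
apply: le_trans (fM _ M1 x) _; apply: ler_wpM2r => //.
by rewrite lecR ler_norm.
Qed.

(* The operator norm; [Re] turns the [R[i]]-valued norm of [Y] into a real. *)
Definition opnorm (f : contlin) : R[i] :=
  (sup [set Re `|f x| | x in [set x | `|x| <= 1]])%:C.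

Lemma opnorm_has_sup (f : contlin) :
  has_sup [set Re `|f x| | x in [set x | `|x| <= 1]].
Proof.
split; first by exists (Re `|f 0|), 0 => //=; rewrite normr0.
have [M M0 fM] := contlin_bounded f.
exists M => _ [x x1 <-]; rewrite -lecR RRe_real ?normr_real//.
by apply: le_trans (fM x) _; rewrite ler_piMr// lecR.
Qed.

Lemma opnorm_ge0 f : 0 <= opnorm f.
Proof.
rewrite lecR; apply: le_trans (ub_le_sup (opnorm_has_sup f).2 _); last first.
  by exists 0 => //=; rewrite normr0.
by rewrite linear0 normr0.
Qed.

Lemma opnormP f x : `|f x| <= opnorm f * `|x|.
Proof.
have [->|x0] := eqVneq x 0; first by rewrite linear0 !normr0 mulr0.
have nx0 : 0 < `|x| by rewrite normr_gt0.
rewrite -ler_pdivrMr// mulrC.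
have -> : `|x|^-1 * `|f x| = `|f (`|x|^-1 *: x)|.
  by rewrite linearZ normrZ ger0_norm// invr_ge0.
rewrite -[leLHS]RRe_real ?normr_real// lecR.
apply: (ub_le_sup (opnorm_has_sup f).2); exists (`|x|^-1 *: x) => //=.
by rewrite normrZ ger0_norm ?invr_ge0// mulVf// gt_eqF.
Qed.

Lemma opnorm_le f (k : R[i]) : 0 <= k -> (forall x, `|f x| <= k * `|x|) ->
  opnorm f <= k.
Proof.
move=> k0 fk; rewrite -(RRe_real (ger0_real k0)) lecR.
apply: ge_sup; first exact: (opnorm_has_sup f).1.
move=> _ [x x1 <-]; rewrite -lecR !RRe_real ?normr_real ?ger0_real//.
by apply: le_trans (fk x) _; rewrite ler_piMr.
Qed.

Lemma opnormD f g : opnorm (f + g) <= opnorm f + opnorm g.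
Proof.
apply: opnorm_le => [|x]; first by rewrite addr_ge0 ?opnorm_ge0.
rewrite mulrDl; apply: le_trans (ler_normD _ _) _.
by apply: lerD; exact: opnormP.
Qed.

Lemma opnormZ k f : opnorm (k *: f) = `|k| * opnorm f.
Proof.
have le_opnormZ c h : opnorm (c *: h) <= `|c| * opnorm h.
  apply: opnorm_le => [|x]; first by rewrite mulr_ge0 ?opnorm_ge0.
  by rewrite contlin_scaleE normrZ -mulrA ler_wpM2l// opnormP.
apply/eqP; rewrite eq_le le_opnormZ/=.
have [->|k0] := eqVneq k 0; first by rewrite normr0 mul0r opnorm_ge0.
rewrite -ler_pdivlMl ?normr_gt0// -normfV.
by apply: le_trans (le_opnormZ _ _); rewrite scalerA mulVf// scale1r.
Qed.

Lemma opnorm0_eq0 f : opnorm f = 0 -> f = 0.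
Proof.
move=> f0; apply: contlinP => x; apply/eqP; rewrite -normr_le0.
by have := opnormP f x; rewrite f0 mul0r.
Qed.

HB.instance Definition _ :=
  Lmodule_isNormed.Build R[i] contlin opnormD opnormZ opnorm0_eq0.

Lemma contlin_normE f : `|f| = opnorm f. Proof. by []. Qed.

End ContinuousLinearMaps.

Section ContinuousLinearMapsComplete.
Variables (R : realType) (X : normedModType R[i]).
Variable Y : completeNormedModType R[i].

Lemma contlin_complete (F : set_system (contlin X Y)) :
  ProperFilter F -> cauchy F -> cvg F.
Proof.
move=> FF /cauchy_ballP Fc.
have {}Fc (e : R[i]) : 0 < e -> \forall f & g \near F,
    forall x, `|(f : contlin X Y) x - (g : contlin X Y) x| <= e * `|x|.
  move=> e0; have := Fc _ e0; rewrite !near_map2.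
  apply: filterS => -[f g] /=; rewrite -ball_normE /= => fge x.
  apply: le_trans (ler_wpM2r _ (ltW fge)) => //.
  exact: (opnormP (f - g)).
have Fx x : cvg ((fun f : contlin X Y => f x) @ F).
  apply: cauchy_cvg; apply/cauchy_ballP => e e0; rewrite near_map2.
  have d0 : 0 < e / (`|x| + 1) by rewrite divr_gt0// ltr_wpDl.
  apply: filterS (Fc _ d0) => -[f g] /= /(_ x) fgx.
  rewrite -ball_normE /=; apply: le_lt_trans fgx _.
  by rewrite mulrAC ltr_pdivrMr ?ltr_pM2l ?ltrDl// ltr_wpDl.
pose g x := lim ((fun f : contlin X Y => f x) @ F).
have lg : linear g.
  move=> k x y; apply: cvg_lim => //.
  under eq_fun do rewrite linearP.
  by apply: cvgD; [apply: cvgZr|]; exact: Fx.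
have Fg (e : R[i]) : 0 < e -> \forall f \near F,
    forall x, `|g x - (f : contlin X Y) x| <= e * `|x|.
  move=> e0; have [[A B] /= [FA FB] AB] := Fc _ e0.
  apply: filterS FA => f Af x; apply/ler_addgt0Pl => d d0.
  have /cvgrPdist_le/(_ _ d0) gh := Fx x.
  have [h [Bh ghd]] := filter_ex (filterI FB gh).
  rewrite -(subrKA (h x)); apply: le_trans (ler_normD _ _) _.
  by apply: lerD => //; rewrite distrC; exact: (AB (f, h)).
have cg : continuous g.
  have [f fg] := filter_ex (Fg _ ltr01).
  have [M M0 fM] := contlin_bounded f.
  pose G : {linear X -> Y} := HB.pack g (GRing.isLinear.Build R[i] X Y *:%R g lg).
  apply: (@linear_continuous_bound _ _ _ G (1 + M)) => x.
  rewrite -(subrK (f x) (G x)) rmorphD mulrDl; apply: le_trans (ler_normD _ _) _.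
  by apply: lerD.
apply/cvg_ex; exists (mk_contlin lg cg); apply/cvgrPdist_le => e e0.
apply: filterS (Fg _ e0) => f fg.
by apply: opnorm_le => //; exact: ltW.
Qed.

HB.instance Definition _ := Uniform_isComplete.Build (contlin X Y) contlin_complete.

End ContinuousLinearMapsComplete.
Lemma contlin_comp_subproof (R : realType) (X Y Z : normedModType R[i])
  (g : contlin Y Z) (f : contlin X Y) :
  linear (g \o f) /\ continuous (g \o f).
Proof.
split; first by move=> k x y /=; rewrite !linearP.
by move=> x; apply: continuous_comp; apply: contlin_continuous.
Qed.

Definition contlin_comp (R : realType) (X Y Z : normedModType R[i])
    (g : contlin Y Z) (f : contlin X Y) : contlin X Z :=
  mk_contlin (contlin_comp_subproof g f).1 (contlin_comp_subproof g f).2.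

Lemma bounded_contlin_subproof (R : realType) (X Y : normedModType R[i])
    (f : X -> Y) (k : R[i]) :
  linear f -> (forall x, `|f x| <= k * `|x|) -> continuous f.
Proof.
move=> lf fk.
pose F : {linear X -> Y} := HB.pack f (GRing.isLinear.Build R[i] X Y *:%R f lf).
apply: (@linear_continuous_bound _ _ _ F (Re `|k|)) => x.
rewrite normc_Re; have [->|x0] := eqVneq x 0.
  by rewrite linear0 !normr0 mulr0.
have kr : 0 <= k.
  by rewrite -(@pmulr_lge0 _ `|x|) ?normr_gt0// (le_trans _ (fk x)).
by rewrite ger0_norm.
Qed.

Definition bounded_contlin (R : realType) (X Y : normedModType R[i])
    (f : X -> Y) (k : R[i]) (lf : linear f)
    (fk : forall x, `|f x| <= k * `|x|) : contlin X Y :=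
  mk_contlin lf (bounded_contlin_subproof lf fk).

Definition dual (R : realType) (X : normedModType R[i]) : Type :=
  contlin X R[i].

HB.instance Definition _ (R : realType) (X : normedModType R[i]) :=
  CompleteNormedModule.on (dual X).

Section Adjoint.
Variables (R : realType) (X Y : normedModType R[i]) (f : contlin X Y).

Let adj (h : dual Y) : dual X := contlin_comp h f.

Lemma adjoint_linear : linear adj.
Proof. by move=> k g h; exact: contlinP. Qed.

Lemma adjoint_bound h : `|adj h| <= `|f| * `|h|.
Proof.
apply: opnorm_le => [|x]; first by rewrite mulr_ge0.
apply: le_trans (opnormP h (f x)) _.
by rewrite mulrAC mulrC ler_wpM2r ?opnorm_ge0// opnormP.
Qed.

Definition adjoint : contlin (dual Y) (dual X) :=
  bounded_contlin adjoint_linear adjoint_bound.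

End Adjoint.

Definition is_bilinear (K : nzRingType) (U V W : lmodType K)
    (B : U -> V -> W) : Prop :=
  (forall v, linear (B^~ v)) /\ (forall u, linear (B u)).

(* Multiplication is a new operation: the ring structures of the library have
   a unit, which a Banach algebra need not have. *)
HB.mixin Record isBanachAlgebra (R : realType) (U : Type)
    of CompleteNormedModule R[i] U := {
  bmul : U -> U -> U;
  bmulA : associative bmul;
  bmul_bilinear : is_bilinear bmul;
  norm_bmul : forall a b, `|bmul a b| <= `|a| * `|b| }.

#[short(type="banachAlgType")]
HB.structure Definition BanachAlgebra (R : realType) :=
  {U of CompleteNormedModule R[i] U & isBanachAlgebra R U}.

Notation "a ** b" := (bmul a b) (at level 40, left associativity).

HB.mixin Record isBanachBimodule (R : realType) (U : banachAlgType R)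
    (X : Type) of CompleteNormedModule R[i] X := {
  lact : U -> X -> X;
  ract : X -> U -> X;
  lact_bilinear : is_bilinear lact;
  ract_bilinear : is_bilinear ract;
  lactM : forall a b x, lact (a ** b) x = lact a (lact b x);
  ractM : forall a b x, ract x (a ** b) = ract (ract x a) b;
  lact_ract : forall a b x, lact a (ract x b) = ract (lact a x) b;
  lact_bounded : exists k, forall a x, `|lact a x| <= k * `|a| * `|x|;
  ract_bounded : exists k, forall x a, `|ract x a| <= k * `|x| * `|a| }.

#[short(type="banachBimodType")]
HB.structure Definition BanachBimodule (R : realType) (U : banachAlgType R) :=
  {X of CompleteNormedModule R[i] X & isBanachBimodule R U X}.

Notation "a *> x" := (lact a x) (at level 40, left associativity).
Notation "x <* a" := (ract x a) (at level 40, left associativity).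

Lemma le_norm_bound (K : numDomainType) (n k u v : K) :
  0 <= n -> 0 <= u -> 0 <= v -> n <= k * u * v -> n <= `|k| * u * v.
Proof.
move=> n0 u0 v0 nle; rewrite (le_trans nle)//.
by rewrite -(ger0_norm (le_trans n0 nle)) !normrM (ger0_norm u0) (ger0_norm v0).
Qed.

Section DualBimodule.
Variables (R : realType) (U : banachAlgType R) (X : banachBimodType U).
Implicit Types (a b : U) (x : X) (f : dual X).

Lemma lact_contlin_subproof a :
  linear (fun x : X => a *> x) /\ continuous (fun x : X => a *> x).
Proof.
have [k hk] := @lact_bounded R U X.
by split; [|apply: (bounded_contlin_subproof _ (hk a))]; exact: lact_bilinear.2.
Qed.

Lemma ract_contlin_subproof a :
  linear (fun x : X => x <* a) /\ continuous (fun x : X => x <* a).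
Proof.
have [k hk] := @ract_bounded R U X.
have hk' x : `|x <* a| <= k * `|a| * `|x| by rewrite mulrAC.
by split; [|apply: (bounded_contlin_subproof _ hk')]; exact: ract_bilinear.1.
Qed.

Definition lact_contlin a : contlin X X :=
  mk_contlin (lact_contlin_subproof a).1 (lact_contlin_subproof a).2.
Definition ract_contlin a : contlin X X :=
  mk_contlin (ract_contlin_subproof a).1 (ract_contlin_subproof a).2.

Definition dual_lact a f : dual X := contlin_comp f (ract_contlin a).
Definition dual_ract f a : dual X := contlin_comp f (lact_contlin a).

Lemma dual_lact_bilinear : is_bilinear dual_lact.
Proof.
split=> [f|a] k u v; apply: contlinP => x //=.
by rewrite (ract_bilinear.2 x k u v) linearP.
Qed.

Lemma dual_ract_bilinear : is_bilinear dual_ract.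
Proof.
split=> [f|a] k u v; apply: contlinP => x //=.
by rewrite (lact_bilinear.1 x k u v) linearP.
Qed.

Lemma dual_lactM a b f : dual_lact (a ** b) f = dual_lact a (dual_lact b f).
Proof. by apply: contlinP => x /=; rewrite ractM. Qed.

Lemma dual_ractM a b f : dual_ract f (a ** b) = dual_ract (dual_ract f a) b.
Proof. by apply: contlinP => x /=; rewrite lactM. Qed.

Lemma dual_lact_ract a b f :
  dual_lact a (dual_ract f b) = dual_ract (dual_lact a f) b.
Proof. by apply: contlinP => x /=; rewrite lact_ract. Qed.

Lemma dual_lact_bounded :
  exists k : R[i], forall a f, `|dual_lact a f| <= k * `|a| * `|f|.
Proof.
have [k hk] := @ract_bounded R U X; exists `|k| => a f.
apply: opnorm_le => [|x]; first by rewrite !mulr_ge0.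
have {}hk := le_norm_bound (normr_ge0 _) (normr_ge0 _) (normr_ge0 _) (hk x a).
apply: le_trans (opnormP f (x <* a)) _.
apply: le_trans (ler_wpM2l (opnorm_ge0 f) hk) _.
by rewrite [leRHS]mulrAC [leRHS]mulrC [X in _ <= _ * X]mulrAC.
Qed.

Lemma dual_ract_bounded :
  exists k : R[i], forall f a, `|dual_ract f a| <= k * `|f| * `|a|.
Proof.
have [k hk] := @lact_bounded R U X; exists `|k| => f a.
apply: opnorm_le => [|x]; first by rewrite !mulr_ge0.
have {}hk := le_norm_bound (normr_ge0 _) (normr_ge0 _) (normr_ge0 _) (hk a x).
apply: le_trans (opnormP f (a *> x)) _.
apply: le_trans (ler_wpM2l (opnorm_ge0 f) hk) _.
by rewrite [X in _ <= X * _]mulrAC [leRHS]mulrAC [leRHS]mulrC.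
Qed.

HB.instance Definition _ := isBanachBimodule.Build R U (dual X)
  dual_lact_bilinear dual_ract_bilinear dual_lactM dual_ractM dual_lact_ract
  dual_lact_bounded dual_ract_bounded.

Lemma dual_lactE a f x : (a *> f) x = f (x <* a).
Proof. by []. Qed.
Lemma dual_ractE a f x : (f <* a) x = f (a *> x).
Proof. by []. Qed.

End DualBimodule.
(* A projective tensor product of [U] and [V] is a Banach space [pt_space]
   with a bilinear contraction [tens] through which every bounded bilinear map
   into a Banach space factors uniquely, with the same bound. This determines
   it up to isometric isomorphism. *)
Record projTensor (R : realType) (U V : completeNormedModType R[i]) : Type :=
  ProjTensor {
  pt_space : completeNormedModType R[i];
  tens : U -> V -> pt_space;
  tens_bilinear : is_bilinear tens;
  norm_tens : forall u v, `|tens u v| <= `|u| * `|v|;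
  tens_universal : forall (Z : completeNormedModType R[i]) (B : U -> V -> Z)
      (k : R[i]), is_bilinear B -> 0 <= k ->
    (forall u v, `|B u v| <= k * `|u| * `|v|) ->
    exists L : contlin pt_space Z,
      [/\ forall u v, L (tens u v) = B u v, `|L| <= k &
          forall L' : contlin pt_space Z,
            (forall u v, L' (tens u v) = B u v) -> L' = L] }.

Definition ptensor (R : realType) (U V : completeNormedModType R[i])
  (P : projTensor U V) : Type := pt_space P.

HB.instance Definition _ (R : realType) (U V : completeNormedModType R[i])
  (P : projTensor U V) := CompleteNormedModule.copy (ptensor P) (pt_space P).

Section PTens.
Variables (R : realType) (U V : completeNormedModType R[i]).
Variable P : projTensor U V.

Definition ptens (u : U) (v : V) : ptensor P := tens P u v.

Lemma ptens_bilinear : is_bilinear ptens.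
Proof. exact: (tens_bilinear P). Qed.

Lemma norm_ptens u v : `|ptens u v| <= `|u| * `|v|.
Proof. exact: (norm_tens P). Qed.

End PTens.

Section TensorLift.
Variables (R : realType) (U V : completeNormedModType R[i]).
Variables (P : projTensor U V) (Z : completeNormedModType R[i]).
Variables (B : U -> V -> Z) (k : R[i]).
Hypotheses (bB : is_bilinear B) (k0 : 0 <= k).
Hypothesis Bk : forall u v, `|B u v| <= k * `|u| * `|v|.

Definition tensor_lift : contlin (ptensor P) Z :=
  projT1 (cid (tens_universal P bB k0 Bk)).

Lemma tensor_liftE u v : tensor_lift (ptens P u v) = B u v.
Proof. by rewrite /tensor_lift; case: cid => L []. Qed.

Lemma norm_tensor_lift : `|tensor_lift| <= k.
Proof. by rewrite /tensor_lift; case: cid => L []. Qed.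

End TensorLift.

Lemma tensor_ext (R : realType) (U V Z : completeNormedModType R[i])
    (P : projTensor U V) (f g : contlin (ptensor P) Z) :
  (forall u v, f (ptens P u v) = g (ptens P u v)) -> f = g.
Proof.
move=> fg; pose B u v := g (ptens P u v).
have bB : is_bilinear B.
  by split=> [v|u] l x y; rewrite /B ?((ptens_bilinear P).1 v l x y)
    ?((ptens_bilinear P).2 u l x y) linearP.
have Bk u v : `|B u v| <= `|g| * `|u| * `|v|.
  apply: le_trans (opnormP g (ptens P u v)) _.
  by rewrite -mulrA ler_wpM2l ?opnorm_ge0// norm_ptens.
have [L [_ _ Lu]] := tens_universal P bB (normr_ge0 g) Bk.
by rewrite (Lu f fg) (Lu g (fun _ _ => erefl)).
Qed.

Section TensorBimodule.
Variables (R : realType) (U : banachAlgType R) (P : projTensor U U).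
Implicit Types a b c : U.

Lemma bmul_norm1 a b : `|a ** b| <= 1 * `|a| * `|b|.
Proof. by rewrite mul1r norm_bmul. Qed.

Definition tensor_pi : contlin (ptensor P) U :=
  tensor_lift P bmul_bilinear ler01 bmul_norm1.

Lemma tensor_piE b c : tensor_pi (ptens P b c) = b ** c.
Proof. exact: tensor_liftE. Qed.

Let lB a b c := ptens P (a ** b) c.
Let rB a b c := ptens P b (c ** a).

Lemma lB_bilinear a : is_bilinear (lB a).
Proof.
split=> [c|b] l x y; rewrite /lB.
  by rewrite (bmul_bilinear.2 a l x y) ((ptens_bilinear P).1 c).
by rewrite ((ptens_bilinear P).2 (a ** b)).
Qed.

Lemma rB_bilinear a : is_bilinear (rB a).
Proof.
split=> [c|b] l x y; rewrite /rB; first by rewrite ((ptens_bilinear P).1 (c ** a)).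
by rewrite (bmul_bilinear.1 a l x y) ((ptens_bilinear P).2 b).
Qed.

Lemma norm_lB a b c : `|lB a b c| <= `|a| * `|b| * `|c|.
Proof. by apply: le_trans (norm_ptens P _ _) _; rewrite ler_wpM2r ?norm_bmul. Qed.

Lemma norm_rB a b c : `|rB a b c| <= `|a| * `|b| * `|c|.
Proof.
apply: le_trans (norm_ptens P _ _) _.
by rewrite mulrAC mulrC ler_wpM2r// mulrC norm_bmul.
Qed.

Let Ll a : contlin (ptensor P) (ptensor P) :=
  tensor_lift P (lB_bilinear a) (normr_ge0 a) (norm_lB a).
Let Lr a : contlin (ptensor P) (ptensor P) :=
  tensor_lift P (rB_bilinear a) (normr_ge0 a) (norm_rB a).

Definition tensor_lact a (t : ptensor P) : ptensor P := Ll a t.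
Definition tensor_ract (t : ptensor P) a : ptensor P := Lr a t.

Let LlE a b c : Ll a (ptens P b c) = ptens P (a ** b) c.
Proof. exact: tensor_liftE. Qed.

Let LrE a b c : Lr a (ptens P b c) = ptens P b (c ** a).
Proof. exact: tensor_liftE. Qed.

Lemma tensor_lact_bilinear : is_bilinear tensor_lact.
Proof.
split=> [t|a]; last exact: linearP.
move=> k a b; rewrite -[RHS]/((k *: Ll a + Ll b) t); congr (contlin_fun _ t).
apply: tensor_ext => u v; rewrite contlin_addE contlin_scaleE !LlE.
by rewrite (bmul_bilinear.1 u k a b) ((ptens_bilinear P).1 v).
Qed.

Lemma tensor_ract_bilinear : is_bilinear tensor_ract.
Proof.
split=> [a|t]; first exact: linearP.
move=> k a b; rewrite -[RHS]/((k *: Lr a + Lr b) t); congr (contlin_fun _ t).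
apply: tensor_ext => u v; rewrite contlin_addE contlin_scaleE !LrE.
by rewrite (bmul_bilinear.2 v k a b) ((ptens_bilinear P).2 u).
Qed.

Lemma tensor_lactM a b t :
  tensor_lact (a ** b) t = tensor_lact a (tensor_lact b t).
Proof.
rewrite -[RHS]/(contlin_comp (Ll a) (Ll b) t); congr (contlin_fun _ t).
by apply: tensor_ext => u v; rewrite /= !LlE bmulA.
Qed.

Lemma tensor_ractM a b t :
  tensor_ract t (a ** b) = tensor_ract (tensor_ract t a) b.
Proof.
rewrite -[RHS]/(contlin_comp (Lr b) (Lr a) t); congr (contlin_fun _ t).
by apply: tensor_ext => u v; rewrite /= !LrE bmulA.
Qed.

Lemma tensor_lact_ract a b t :
  tensor_lact a (tensor_ract t b) = tensor_ract (tensor_lact a t) b.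
Proof.
rewrite -[LHS]/(contlin_comp (Ll a) (Lr b) t).
rewrite -[RHS]/(contlin_comp (Lr b) (Ll a) t); congr (contlin_fun _ t).
by apply: tensor_ext => u v; rewrite /= !(LlE, LrE).
Qed.

Lemma tensor_lact_bounded :
  exists k : R[i], forall a t, `|tensor_lact a t| <= k * `|a| * `|t|.
Proof.
exists 1 => a t; rewrite mul1r; apply: le_trans (opnormP (Ll a) t) _.
by apply: ler_wpM2r => //; exact: norm_tensor_lift.
Qed.

Lemma tensor_ract_bounded :
  exists k : R[i], forall t a, `|tensor_ract t a| <= k * `|t| * `|a|.
Proof.
exists 1 => t a; rewrite mul1r mulrC; apply: le_trans (opnormP (Lr a) t) _.
by apply: ler_wpM2r => //; exact: norm_tensor_lift.
Qed.

HB.instance Definition _ := isBanachBimodule.Build R U (ptensor P)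
  tensor_lact_bilinear tensor_ract_bilinear tensor_lactM tensor_ractM
  tensor_lact_ract tensor_lact_bounded tensor_ract_bounded.

Lemma tensor_lactE a b c :
  a *> ptens P b c = ptens P (a ** b) c.
Proof. exact: LlE. Qed.

Lemma tensor_ractE a b c :
  ptens P b c <* a = ptens P b (c ** a).
Proof. exact: LrE. Qed.

End TensorBimodule.

Section Characters.
Variables (R : realType) (U : banachAlgType R).

Definition Delta : set (U -> R[i]) :=
  [set phi | [/\ linear phi, forall a b, phi (a ** b) = phi a * phi b &
                 exists a, phi a != 0]].

(* Characters are automatically continuous, so that [Delta U] lies in
   [dual U] although continuity is not part of its definition. *)
Lemma Delta_norm (phi : U -> R[i]) : Delta phi ->
  forall a, `|phi a| <= 1 * `|a|.
Proof.
move=> [lphi phiM _] a; rewrite mul1r; apply: contrapT => /negP.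
rewrite real_leNgt ?normr_real// negbK => a_lt.
pose F : {linear U -> R[i]} :=
  HB.pack phi (GRing.isLinear.Build R[i] U R[i] *:%R phi lphi).
have phiM' b c : F (b ** c) = F b * F c by exact: phiM.
have Fa0 : F a != 0 by rewrite -normr_gt0; apply: le_lt_trans a_lt.
pose c := (F a)^-1 *: a.
have Fc : F c = 1 by rewrite linearZ /= -[_ *: _]/(_ * _) mulVf.
pose r : R := Re `|c|.
have nc : `|c| = r%:C by rewrite RRe_real ?normr_real.
have r0 : 0 <= r by rewrite -ler0c -nc.
have r1 : r < 1.
  by rewrite -ltcR -nc normrZ normfV ltr_pdivrMl ?normr_gt0// mulr1.
pose s := fix s n := if n is m.+1 then c + c ** s m else c.
have mulB x y : c ** x - c ** y = c ** (x - y).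
  have := bmul_bilinear.2 c (-1) y x.
  by rewrite !scaleN1r ![- _ + _]addrC => ->.
pose K : R := (1 - r)^-1.
have K0 : 0 < K by rewrite invr_gt0 subr_gt0.
have KE : 1 + r * K = K.
  have <- : K - r * K = 1 by rewrite -{1}(mul1r K) -mulrBl mulfV// subr_eq0 gt_eqF.
  by rewrite subrK.
have sK n : `|s n| <= K%:C.
  elim: n => [|n IH] /=.
    by rewrite nc lecR (le_trans (ltW r1))// -KE lerDl mulr_ge0// ltW.
  apply: le_trans (ler_normD _ _) _; rewrite -KE rmorphD rmorphM /=.
  apply: lerD; first by rewrite nc lecR ltW.
  by apply: le_trans (norm_bmul _ _) _; rewrite -nc ler_wpM2l.
have sB k n m : `|s (k + n)%N - s (k + m)%N| <= (r ^+ k * (K + K))%:C.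
  elim: k => [|k IH].
    by rewrite expr0 mul1r rmorphD; apply: le_trans (ler_normB _ _) _; apply: lerD.
  rewrite !addSn /= opprD addrACA subrr add0r mulB.
  apply: le_trans (norm_bmul _ _) _.
  by rewrite exprS -mulrA rmorphM/= -nc ler_wpM2l.
have /cvg_ex[/= l sl] : cvg (s @ \oo).
  apply: cauchy_cvg; apply/cauchy_ballP => e e0; rewrite near_map2.
  have ReE : e = (Re e)%:C by rewrite RRe_real ?gtr0_real.
  have e0' : 0 < Re e / (K + K) by rewrite divr_gt0 ?addr_gt0// -ltcR -ReE.
  have rr : `|r| < 1 by rewrite ger0_norm.
  have /cvgrPdist_lt/(_ _ e0')[N _ /(_ N (leqnn N))] := cvg_expr rr.
  rewrite /= sub0r normrN ger0_norm ?exprn_ge0// ltr_pdivlMr ?addr_gt0// => rN.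
  exists ([set n | (N <= n)%N], [set n | (N <= n)%N]); first by split; exists N.
  move=> [n m] /= [Nn Nm]; rewrite -ball_normE /= -(subnKC Nn) -(subnKC Nm).
  by apply: le_lt_trans (sB _ _ _) _; rewrite ReE ltcR.
have norm_c x : `|c ** x| <= `|c| * `|x| by exact: norm_bmul.
pose L := bounded_contlin (bmul_bilinear.2 c) norm_c.
have csl : (c + L (s n)) @[n --> \oo] --> c + L l.
  apply: cvgD; first exact: cvg_cst.
  exact: (cvg_comp _ _ sl (@contlin_continuous _ _ _ L l)).
have sl1 : s n.+1 @[n --> \oo] --> l by rewrite (cvg_shiftS s).
have ll : l = c ** l + c.
  by rewrite addrC; exact: (cvg_unique _ sl1 csl).
have := congr1 F ll; rewrite linearD phiM' Fc mul1r => /eqP.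
by rewrite -subr_eq0 opprD addNKr oppr_eq0 oner_eq0.
Qed.

Definition Delta_dual (phi : U -> R[i]) (phiD : Delta phi) : dual U :=
  bounded_contlin (let: And3 lphi _ _ := phiD in lphi) (Delta_norm phiD).

Lemma Delta_dualE (phi : U -> R[i]) (phiD : Delta phi) a :
  Delta_dual phiD a = phi a.
Proof. by []. Qed.

End Characters.
Section Amenability.
Variables (R : realType) (U : banachAlgType R).

Definition is_derivation (X : banachBimodType U) (delta : U -> X) : Prop :=
  linear delta /\
  forall a b, delta (a ** b) = delta a <* b + a *> delta b.

Definition is_inner (X : banachBimodType U) (delta : U -> X) : Prop :=
  exists x : X, forall a, delta a = a *> x - x <* a.

Definition amenable : Prop :=
  forall (X : banachBimodType U) (delta : U -> dual X),
    is_derivation delta -> continuous delta -> is_inner delta.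

Definition character_amenable : Prop :=
  forall phi : U -> R[i], (@Delta R U `|` [set cst 0]) phi ->
  forall X : banachBimodType U,
    (forall (a : U) (x : X), x <* a = phi a *: x) \/
    (forall (a : U) (x : X), a *> x = phi a *: x) ->
  forall delta : U -> dual X,
    is_derivation delta -> continuous delta -> is_inner delta.

(* [adjoint (adjoint (tensor_pi P))] is the second adjoint of the product map,
   and its value at [m] is a functional on [dual U], evaluated at [phi]. *)
Definition johnson_amenable (phi : U -> R[i]) (phiD : Delta phi) : Prop :=
  exists (P : projTensor U U) (m : dual (dual (ptensor P))),
    (forall a : U, a *> m = m <* a) /\
    adjoint (adjoint (tensor_pi P)) m (Delta_dual phiD) = 1.

Definition point_jordan_derivation (phi delta : U -> R[i]) : Prop :=
  linear delta /\ forall a, delta (a ** a) = 2 * phi a * delta a.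

End Amenability.

Arguments amenable {R} U.
Arguments character_amenable {R} U.

(* Main.v *)
(* For [delta] a point Jordan derivation at [phi] and [c] in [U], the map
   [x |-> delta (x c) - delta (c x)] is a genuine point derivation at [phi]:
   the polarised Jordan identity at the pairs [(b c, a)] and [(c a, b)] gives
   [delta (a b c) - delta (c a b)], because [delta (b c a)] cancels. If point
   derivations vanish, [delta] therefore is one itself, hence [delta = 0].
   Character amenability kills a point derivation [d] since the bimodule [C]
   at [phi] is symmetric, so that its only inner derivation is [0]. With
   [m] as in [phi]-Johnson amenability, applying [a m = m a] to the functional
   [T (b (x) c) = phi b * d c], for which [T a = phi a T] and
   [a T = d a (phi o pi) + phi a T], gives [d a = 0]. *)
From HB Require Import structures.
Require Import Defs.
From mathcomp Require Import all_boot all_order all_algebra complex.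
From mathcomp Require Import ring.
From mathcomp Require Import boolp classical_sets reals topology normedtype.
Set Implicit Arguments.
Unset Strict Implicit.
Unset Printing Implicit Defensive.
Import Order.TTheory GRing.Theory Num.Theory.
Import numFieldNormedType.Exports.
Local Open Scope ring_scope.
Local Open Scope complex_scope.

Definition point_derivation (R : realType) (U : banachAlgType R)
    (phi d : U -> R[i]) : Prop :=
  linear d /\ forall a b, d (a ** b) = phi a * d b + phi b * d a.

(** Bundling a functional gives access to its operator norm and to continuity of compositions. *)
Lemma linear_contlin (R : realType) (X Y : normedModType R[i]) (f : X -> Y) :
  linear f -> continuous f -> exists F : contlin X Y, f = F.
Proof. by move=> lf cf; exists (mk_contlin lf cf). Qed.

Section JordanDerivation.
Variables (R : realType) (U : banachAlgType R) (phi delta : U -> R[i]).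
Hypotheses (phi_lin : linear phi) (phiM : forall a b, phi (a ** b) = phi a * phi b).
Hypothesis deltaJ : point_jordan_derivation phi delta.

Let deltaD x y : delta (x + y) = delta x + delta y.
Proof. by have := deltaJ.1 1 x y; rewrite !scale1r. Qed.

Let phiD x y : phi (x + y) = phi x + phi y.
Proof. by have := phi_lin 1 x y; rewrite !scale1r. Qed.

Let bmulDl (a b c : U) : (a + b) ** c = a ** c + b ** c.
Proof. by have := bmul_bilinear.1 c 1 a b; rewrite !scale1r. Qed.

Let bmulDr (a b c : U) : c ** (a + b) = c ** a + c ** b.
Proof. by have := bmul_bilinear.2 c 1 a b; rewrite !scale1r. Qed.

(** Expand the Jordan identity at [a + b] and cancel the square terms, which are those of the
    identities at [a] and at [b]. *)
Lemma point_jordan_polar a b :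
  delta (a ** b) + delta (b ** a) = 2 * (phi a * delta b + phi b * delta a).
Proof.
have := deltaJ.2 (a + b).
rewrite bmulDl !bmulDr !deltaD phiD !deltaJ.2 => e.
transitivity (2 * phi a * delta a + delta (a ** b)
  + (delta (b ** a) + 2 * phi b * delta b)
  - 2 * phi a * delta a - 2 * phi b * delta b); first by ring.
by rewrite e; ring.
Qed.

Lemma point_derivation_commutator c :
  point_derivation phi (fun x => delta (x ** c) - delta (c ** x)).
Proof.
split=> [k x y|a b].
  rewrite (bmul_bilinear.1 c k x y) (bmul_bilinear.2 c k x y) !deltaJ.1.
  by rewrite -![_ *: _]/(_ * _); ring.
have e1 := point_jordan_polar (b ** c) a.
have e2 := point_jordan_polar (c ** a) b.
have e3 := point_jordan_polar b c.
have e4 := point_jordan_polar c a.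
rewrite !phiM in e1 e2.
rewrite -bmulA in e1; rewrite -(bmulA c) in e2.
have -> : delta (a ** b ** c) - delta (c ** (a ** b)) =
  (delta (b ** (c ** a)) + delta (a ** (b ** c))) -
  (delta (c ** (a ** b)) + delta (b ** (c ** a))) by rewrite -bmulA; ring.
rewrite e1 e2.
(* Only [delta (b ** c)] and [delta (c ** a)] occur on the left, so the reversed products are
   eliminated; the resulting terms [2 * phi a * phi b * delta c] have opposite signs and cancel. *)
have -> : delta (c ** b) = 2 * (phi b * delta c + phi c * delta b)
  - delta (b ** c) by rewrite -e3; ring.
have -> : delta (a ** c) = 2 * (phi c * delta a + phi a * delta c)
  - delta (c ** a) by rewrite -e4; ring.
by ring.
Qed.

Lemma point_jordan_derivation_eq0 :
  (forall d : U -> R[i], point_derivation phi d -> continuous d ->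
    forall a, d a = 0) ->
  continuous delta -> forall a, delta a = 0.
Proof.
move=> d0 cdelta; apply: (d0 delta) => //; split; first exact: deltaJ.1.
move=> a b.
(* Once [delta (a ** b)] and [delta (b ** a)] agree, the polarised identity is twice the Leibniz
   rule. *)
have /eqP : delta (a ** b) - delta (b ** a) = 0.
  apply: (d0 _ (point_derivation_commutator b)).
  have [F ->] := linear_contlin deltaJ.1 cdelta.
  have nr x : `|x ** b| <= `|b| * `|x| by rewrite mulrC norm_bmul.
  have nl x : `|b ** x| <= `|b| * `|x| by exact: norm_bmul.
  (* [G] is convertible to the commutator map and is continuous by construction. *)
  pose G := contlin_comp F (bounded_contlin (bmul_bilinear.1 b) nr)
    - contlin_comp F (bounded_contlin (bmul_bilinear.2 b) nl).
  exact: (@contlin_continuous _ _ _ G).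
rewrite subr_eq0 => /eqP ab.
have two0 : 2 != 0 :> R[i] by rewrite pnatr_eq0.
apply: (mulfI two0); rewrite -point_jordan_polar -ab; ring.
Qed.

End JordanDerivation.

Section JohnsonAmenable.
Variables (R : realType) (U : banachAlgType R) (phi : U -> R[i]).

Lemma johnson_amenable_point_derivation (phiD : Delta phi) (d : U -> R[i]) :
  johnson_amenable phiD -> point_derivation phi d -> continuous d ->
  forall a, d a = 0.
Proof.
move=> [P [m [am m1]]] [ld dM] cd a.
have [D dE] := linear_contlin ld cd; rewrite {}dE in dM ld *.
have [lphi phiM _] := phiD.
pose B b c : R[i] := phi b * D c.
have bB : is_bilinear B.
  split=> [c|b] k x y; rewrite /B.
    by rewrite lphi -![_ *: _]/(_ * _); ring.
  by rewrite ld -![_ *: _]/(_ * _); ring.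
(* Characters are contractive, so the norm of [D] alone bounds [B]. *)
have Bk b c : `|B b c| <= `|D| * `|b| * `|c|.
  rewrite normrM mulrAC mulrC; apply: ler_pM => //; first exact: opnormP.
  by have := Delta_norm phiD b; rewrite mul1r.
pose T : dual (ptensor P) := tensor_lift P bB (normr_ge0 _) Bk.
have TE b c : T (ptens P b c) = phi b * D c by exact: tensor_liftE.
have Ta : T <* a = phi a *: T.
  apply: tensor_ext => b c.
  rewrite dual_ractE tensor_lactE contlin_scaleE !TE phiM.
  by rewrite -[_ *: _]/(_ * _); ring.
(* Here [a] multiplies the second factor, where the Leibniz rule applies; the term
   [phi b * phi c * D a] is [D a] times the character of [b ** c]. *)
have aT : a *> T = D a *: adjoint (tensor_pi P) (Delta_dual phiD) + phi a *: T.
  apply: tensor_ext => b c.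
  rewrite dual_lactE tensor_ractE contlin_addE !contlin_scaleE !TE /=.
  rewrite tensor_piE phiM dM -![_ *: _]/(_ * _); ring.
(* The terms [phi a * m T] on the two sides cancel, and the normalisation of [m] turns what remains
   into [D a = 0]. *)
have := congr1 (fun F : dual (dual (ptensor P)) => F T) (am a).
rewrite dual_lactE dual_ractE Ta aT linearD !linearZ /= => /esym/eqP.
rewrite -subr_eq0 addrK => /eqP.
rewrite -[_ *: _]/(_ * _).
rewrite -[X in _ * X]/(adjoint (adjoint (tensor_pi P)) m (Delta_dual phiD)).
by rewrite m1 mulr1.
Qed.

End JohnsonAmenable.

(** The index [phiD] keeps the character in the type, so that each character puts its own bimodule
    structure on the complex numbers. *)
Definition point_module (R : realType) (U : banachAlgType R) (phi : U -> R[i])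
  (phiD : Delta phi) : Type := R[i].

HB.instance Definition _ (R : realType) (U : banachAlgType R)
  (phi : U -> R[i]) (phiD : Delta phi) :=
  CompleteNormedModule.copy (point_module phiD) R[i].

Section PointModule.
Variables (R : realType) (U : banachAlgType R) (phi : U -> R[i]).
Variable phiD : Delta phi.

Let la (a : U) (z : point_module phiD) : point_module phiD := phi a *: z.
Let ra (z : point_module phiD) (a : U) : point_module phiD := phi a *: z.

Let la_bilinear : is_bilinear la.
Proof.
have [lphi _ _] := phiD; split=> [z|a] k x y; rewrite /la.
  by rewrite lphi scalerDl scalerA.
by rewrite scalerDr !scalerA mulrC.
Qed.

Let ra_bilinear : is_bilinear ra.
Proof. by split=> [a|z]; [exact: la_bilinear.2|exact: la_bilinear.1]. Qed.

Let laM a b z : la (a ** b) z = la a (la b z).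
Proof. by have [_ phiM _] := phiD; rewrite /la phiM scalerA. Qed.

Let raM a b z : ra z (a ** b) = ra (ra z a) b.
Proof. by have [_ phiM _] := phiD; rewrite /ra phiM scalerA mulrC. Qed.

Let la_ra a b z : la a (ra z b) = ra (la a z) b.
Proof. by rewrite /la /ra !scalerA mulrC. Qed.

Let la_bounded : exists k : R[i], forall a z, `|la a z| <= k * `|a| * `|z|.
Proof. by exists 1 => a z; rewrite normrZ ler_wpM2r// Delta_norm. Qed.

Let ra_bounded : exists k : R[i], forall z a, `|ra z a| <= k * `|z| * `|a|.
Proof.
by exists 1 => z a; rewrite mulrAC normrZ ler_wpM2r// Delta_norm.
Qed.

HB.instance Definition _ := isBanachBimodule.Build R U (point_module phiD)
  la_bilinear ra_bilinear laM raM la_ra la_bounded ra_bounded.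

Lemma point_module_lactE (a : U) (z : point_module phiD) : a *> z = phi a *: z.
Proof. by []. Qed.

Lemma point_module_ractE (a : U) (z : point_module phiD) : z <* a = phi a *: z.
Proof. by []. Qed.

Lemma character_amenable_point_derivation (d : U -> R[i]) :
  character_amenable U -> point_derivation phi d -> continuous d ->
  forall a, d a = 0.
Proof.
move=> Ucam [ld dM] cd a.
have [D dE] := linear_contlin ld cd; rewrite {}dE in dM ld *.
have lin_mul (w : R[i]) : linear (fun z : point_module phiD => w *: z).
  by move=> k x y; rewrite scalerDr !scalerA mulrC.
have bnd_mul (w : R[i]) (z : point_module phiD) : `|w *: z| <= `|w| * `|z|.
  by rewrite normrZ.
(* Amenability concerns derivations into a dual, so scalars are identified with functionals on the
   one-dimensional module. *)
pose mul w : dual (point_module phiD) :=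
  bounded_contlin (lin_mul w) (bnd_mul w).
have lmul : linear (fun b => mul (D b)).
  move=> k b c; apply: contlinP => z.
  rewrite contlin_addE contlin_scaleE /= ld.
  by rewrite -![_ *: _]/(_ * _); ring.
have mulD_bound b : `|mul (D b)| <= `|D| * `|b|.
  apply: opnorm_le => [|z]; first by rewrite mulr_ge0.
  by rewrite normrZ ler_wpM2r// opnormP.
have [|f /(_ a) Daf] := Ucam phi (or_introl phiD) (point_module phiD)
  (or_introl (fun _ _ => erefl)) (fun b => mul (D b)) _
  (bounded_contlin_subproof lmul mulD_bound).
  split=> // b c; apply: contlinP => z.
  rewrite contlin_addE dual_lactE dual_ractE /=.
  rewrite point_module_lactE point_module_ractE dM.
  by rewrite -![_ *: _]/(_ * _); ring.
(* Evaluation at 1 undoes this identification; both actions scale by [phi a], so the inner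
   derivation gives 0 there. *)
have := congr1 (fun F : dual (point_module phiD) => F (1 : R[i])) Daf.
rewrite -[RHS]/((a *> f) (1 : R[i]) - (f <* a) (1 : R[i])).
rewrite dual_lactE dual_ractE point_module_lactE point_module_ractE subrr /=.
by rewrite -[_ *: _]/(_ * _) mulr1.
Qed.

End PointModule.

Lemma amenable_character_amenable (R : realType) (U : banachAlgType R) :
  amenable U -> character_amenable U.
Proof. by move=> Uam phi _ X _; exact: Uam. Qed.

Theorem corollary4p4 (R : realType) (U : banachAlgType R) :
  (forall (phi : U -> R[i]) (phiD : Delta phi), johnson_amenable phiD ->
     forall delta : U -> R[i], point_jordan_derivation phi delta ->
       continuous delta -> forall a, delta a = 0) /\
  (character_amenable U ->
     forall phi : U -> R[i], Delta phi ->
     forall delta : U -> R[i], point_jordan_derivation phi delta ->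
       continuous delta -> forall a, delta a = 0) /\
  (amenable U ->
     forall phi : U -> R[i], Delta phi ->
     forall delta : U -> R[i], point_jordan_derivation phi delta ->
       continuous delta -> forall a, delta a = 0).
Proof.
(* The character amenable case comes first because the amenable case reduces to it. *)
have cam : character_amenable U -> forall phi : U -> R[i], Delta phi ->
    forall delta : U -> R[i], point_jordan_derivation phi delta ->
    continuous delta -> forall a, delta a = 0.
  move=> Ucam phi phiD delta deltaJ; have [lphi phiM _] := phiD.
  apply: (point_jordan_derivation_eq0 lphi phiM deltaJ) => d.
  exact: character_amenable_point_derivation phiD d Ucam.
split=> [phi phiD Uphi delta deltaJ|]; last first.
  by split=> // /amenable_character_amenable.
have [lphi phiM _] := phiD.
apply: (point_jordan_derivation_eq0 lphi phiM deltaJ) => d.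
exact: johnson_amenable_point_derivation Uphi.
Qed.
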